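(* Let $X$ be a compact space and let $A$ be a uniform algebra on $X$. Set $E=\{x\in X:\overline{J_x}\neq M_x\}$. Suppose that $E$ has no non-empty, perfect subsets. Then (a) $\Phi_A=X$; (b) $A$ is normal.
   Context: A compact space is a compact, Hausdorff topological space. $C(X)$ is the algebra of all continuous, complex-valued functions on $X$. A function algebra on $X$ is a subalgebra of $C(X)$ which contains the constant functions and separates the points of $X$; a Banach function algebra on $X$ is a function algebra on $X$ with a complete algebra norm; a uniform algebra on $X$ is a Banach function algebra on $X$ whose norm is the uniform norm on $X$. $\Phi_A$ denotes the character space of $A$. The set of evaluation characters $\{\epsilon_x:x\in X\}$, $\epsilon_x(f)=f(x)$, is identified with $X$; thus $\Phi_A=X$ means that every character of $A$ is evaluation at some point of $X$. For $x\in X$, $M_x=\{f\in A:f(x)=0\}$ and $J_x=\{f\in A: f^{-1}(\{0\})\text{ is a neighbourhood of }x\}$; $\overline{J_x}$ is the closure of $J_x$ in $A$. A perfect subset of $X$ is a closed subset without isolated points. $A$ is normal on $X$ if for every pair of disjoint closed sets $E_1,E_2\subseteq X$ there is $f\in A$ with $f(E_1)\subseteq\{0\}$ and $f(E_2)\subseteq\{1\}$; $A$ is normal if it is normal on $\Phi_A$ (regarding $A$, via the Gelfand transform, as a function algebra on $\Phi_A$). *)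

(* Defs.v *)
From HB Require Import structures.
From mathcomp Require Import all_boot all_order all_algebra.
From mathcomp.real_closed Require Import complex.
From mathcomp Require Import all_classical all_reals all_analysis.

Set Implicit Arguments.
Unset Strict Implicit.
Unset Printing Implicit Defensive.

Import Order.TTheory GRing.Theory Num.Theory numFieldNormedType.Exports.
Local Open Scope classical_set_scope.
Local Open Scope ring_scope.

(* R[i] itself carries no topology; declared at type numClosedFieldType, it gets
   the usual one from the instances of numFieldNormedType. *)
Definition cplx (R : realType) : numClosedFieldType := complex R.

Definition compact_space (X : topologicalType) : Prop :=
  compact [set: X] /\ hausdorff_space X.

Section FunctionAlgebras.
Context {R : realType} {X : topologicalType}.
Implicit Types (A S : set (X -> cplx R)) (N : (X -> cplx R) -> R).

(* Closure under scalar multiplication follows from fa_cst and fa_mul. *)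
Record function_algebra A : Prop := FunctionAlgebra {
  fa_continuous : forall f, A f -> continuous f;
  fa_cst : forall c : cplx R, A (cst c);
  fa_add : forall f g, A f -> A g -> A (f \+ g);
  fa_mul : forall f g, A f -> A g -> A (f \* g);
  fa_separates : forall x y : X, x != y -> exists2 f, A f & f x != f y }.

(* N is a total function, but only its restriction to A matters. *)
Record algebra_norm A N : Prop := AlgebraNorm {
  an_ge0 : forall f, A f -> 0 <= N f;
  an_eq0 : forall f, A f -> N f = 0 -> f = cst 0;
  an_scale : forall (c : cplx R) f, A f ->
    N (c \*: f) = ComplexField.Normc.normc c * N f;
  an_add : forall f g, A f -> A g -> N (f \+ g) <= N f + N g;
  an_mul : forall f g, A f -> A g -> N (f \* g) <= N f * N g }.

Definition complete_norm A N : Prop :=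
  forall u : nat -> X -> cplx R, (forall n, A (u n)) ->
    (forall e : R, 0 < e -> exists n0 : nat, forall m n : nat,
      (n0 <= m)%N -> (n0 <= n)%N -> N (u m \- u n) < e) ->
    exists2 f, A f & (fun n => N (u n \- f)) @ \oo --> (0 : R).

Definition banach_function_algebra A N : Prop :=
  [/\ function_algebra A, algebra_norm A N & complete_norm A N].

(* The supremum is finite when X is compact and f is continuous; it is 0 when X
   is empty. *)
Definition uniform_norm (f : X -> cplx R) : R :=
  sup (range (fun x => ComplexField.Normc.normc (f x))).

Definition uniform_algebra A : Prop := banach_function_algebra A uniform_norm.

Definition max_ideal A (x : X) : set (X -> cplx R) :=
  [set f | A f /\ f x = 0].

Definition local_ideal A (x : X) : set (X -> cplx R) :=
  [set f | A f /\ nbhs x (f @^-1` [set 0])].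

(* closure of S in the normed space (A, N) *)
Definition norm_closure A N S : set (X -> cplx R) :=
  [set f | A f /\ forall e : R, 0 < e -> exists2 g, S g & N (f \- g) < e].

(* Here a set A coerces to the type of its elements, so that functions on A are
   functions of type A -> cplx R.  The algebraic operations of A are those of
   X -> cplx R, read through val. *)
Record is_character A (phi : A -> cplx R) : Prop := IsCharacter {
  char_add : forall f g h : A, val h = val f \+ val g -> phi h = phi f + phi g;
  char_scale : forall (c : cplx R) (f h : A),
    val h = c \*: val f -> phi h = c * phi f;
  char_mul : forall f g h : A, val h = val f \* val g -> phi h = phi f * phi g;
  char_neq0 : exists f : A, phi f != 0 }.

(* As a set in the product space {ptws A -> cplx R}; the corresponding subtype
   carries the subspace topology, which is the Gelfand topology. *)
Definition character_space A : set {ptws A -> cplx R} :=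
  [set phi | is_character phi].
Arguments character_space A : clear implicits.

Definition evaluation A (x : X) : {ptws A -> cplx R} := fun f : A => val f x.
Arguments evaluation A x : clear implicits.

Definition gelfand_transform A (f : A) : character_space A -> cplx R :=
  fun phi => val phi f.

End FunctionAlgebras.

Arguments character_space {R X} A _.
Arguments evaluation {R X} A x _.

Definition normal_on {R : realType} (Y : topologicalType)
    (B : set (Y -> cplx R)) : Prop :=
  forall E1 E2 : set Y, closed E1 -> closed E2 -> E1 `&` E2 = set0 ->
    exists2 f, B f & f @` E1 `<=` [set 0] /\ f @` E2 `<=` [set 1].

Definition normal_algebra {R : realType} {X : topologicalType}
    (A : set (X -> cplx R)) : Prop :=
  normal_on (range (@gelfand_transform R X A)).

(* Main.v *)
Require Import Defs.
From mathcomp Require Import all_boot all_order all_algebra.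
From mathcomp.real_closed Require Import complex.
From mathcomp Require Import all_classical all_reals all_analysis.
From mathcomp Require Import ring lra.

Set Implicit Arguments.
Unset Strict Implicit.
Unset Printing Implicit Defensive.

Import Order.TTheory GRing.Theory Num.Theory numFieldNormedType.Exports.
Local Open Scope classical_set_scope.
Local Open Scope ring_scope.

(** Both parts follow from one fact: every maximal ideal [I] of [A] is some
    [M_x], and [x] is the only point [y] with [J_y] contained in [I]. Indeed the
    kernel of a character is a maximal ideal, which gives (a). For (b), if
    [E1] and [E2] are closed and the functions vanishing on [E1] and those
    vanishing on [E2] span a proper ideal, take a maximal ideal [I] above it
    and the corresponding [x]. On every closed set that misses [x] some
    function of [A] outside [I] vanishes, so [x] must lie in both [E1] and
    [E2].

    Call the set [T] of the points [y] with [J_y] contained in [I] the carrier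
    of [I]. It is closed. As [I] is prime, compactness gives, for every closed
    [K] disjoint from [T], a function [u] of [A] that vanishes on [K] and is
    not in [I] (carrier_disjoint_vanish); with [K = X] this shows that [T] is
    not empty. If [y] is in [T] but not in [E], the closure [M_y] of [J_y] is
    contained in [I], so [I = M_y]; hence [T] has at most one point off [E].

    Suppose that [x] and [y] are distinct points of [T]; choose [q] in [A] with
    [q x = 0] and [q y = 1]. For [0 < r < 1], the line [Re q = r] meets [T]:
    otherwise some [u] outside [I] vanishes on a strip around it, and then
    [u = u1 + u2], where [u1] and [u2] are the restrictions of [u] to the two
    sides of the strip, extended by [0]. Both belong to [A]
    (split_along_strip), one vanishes near [x] and the other near [y], so both
    are in [I], and so is [u] (carrier_no_gap). Thus [Re q] maps [T] onto
    [[0, 1]], and a closed part of [T] inside [E] onto a smaller interval. A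
    minimal closed set with the latter property is perfect
    (perfect_subset_of_interval_preimage), contrary to the hypothesis on [E].
    So [T] is a single point [x] (carrier_singleton). If [q] in [M_x] were not
    in [I], it would have an inverse [p] modulo [I]; multiplying some [u]
    outside [I], supported where [q p] is small, by the powers of [q p] would
    not change [u] modulo [I], but give functions tending to [0]. As [I] is
    closed, this is absurd, so [I = M_x] (carrier_set1).

    The splitting of [u] relies on the completeness of [A]: functions supported
    off the strip are a module over a closed algebra in which one may invert any
    [b] with [Re b] bounded away from [0] off the strip, and Newton's iteration
    for the square roots of [1] then produces the indicator function of a
    half-plane as a uniform limit. *)

(** * Real modulus and real part *)

Definition modulus {R : realType} (z : cplx R) : R := ComplexField.Normc.normc z.

Definition real_part {R : realType} (z : cplx R) : R := complex.Re z.

Section Modulus.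
Context {R : realType}.
Implicit Types (z w : cplx R) (r : R).

Lemma modulusE z : `|z| = (modulus z)%:C%C :> cplx R.
Proof. by case: z. Qed.

Lemma modulus_ge0 z : 0 <= modulus z.
Proof. by have := normr_ge0 z; rewrite modulusE lecR. Qed.

Lemma modulusD z w : modulus (z + w) <= modulus z + modulus w.
Proof. exact: le_normcD. Qed.

Lemma modulusN z : modulus (- z) = modulus z.
Proof. exact: normcN. Qed.

Lemma modulusB z w : modulus (z - w) <= modulus z + modulus w.
Proof. by rewrite -(modulusN w); exact: modulusD. Qed.

Lemma modulus_distC z w : modulus (z - w) = modulus (w - z).
Proof. by rewrite -modulusN opprB. Qed.

Lemma modulusM z w : modulus (z * w) = modulus z * modulus w.
Proof. exact: ComplexField.Normc.normcM. Qed.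

Lemma modulusV z : modulus z^-1 = (modulus z)^-1.
Proof. exact: ComplexField.Normc.normcV. Qed.

Lemma modulus0 : modulus 0 = 0 :> R.
Proof. exact: ComplexField.Normc.normc0. Qed.

Lemma modulus1 : modulus 1 = 1 :> R.
Proof. exact: ComplexField.Normc.normc1. Qed.

Lemma modulusX z n : modulus (z ^+ n) = modulus z ^+ n.
Proof.
by elim: n => [|n IH]; rewrite ?expr0 ?modulus1// !exprS modulusM IH.
Qed.

Lemma modulus_real r : modulus r%:C%C = `|r|.
Proof. by rewrite /modulus /= expr0n addr0 sqrtr_sqr. Qed.

Lemma modulus_imaginary r : modulus ('i%C * r%:C%C) = `|r|.
Proof.
rewrite modulusM modulus_real /modulus /= expr0n expr1n add0r sqrtr1.
by rewrite mul1r.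
Qed.

Lemma modulus_eq0 z : modulus z = 0 -> z = 0.
Proof. exact: ComplexField.Normc.eq0_normc. Qed.

Lemma modulus_small z : (forall e : R, 0 < e -> modulus z <= e) -> z = 0.
Proof.
move=> H; apply: modulus_eq0; apply/eqP; rewrite eq_le modulus_ge0 andbT.
by apply/ler_addgt0Pr => e e0; rewrite add0r; exact: H.
Qed.

Lemma real_partD z w : real_part (z + w) = real_part z + real_part w.
Proof. by case: z w => [a b] [c d]. Qed.

Lemma real_partN z : real_part (- z) = - real_part z.
Proof. by case: z. Qed.

Lemma real_partZ r z : real_part (r%:C%C * z) = r * real_part z.
Proof. by case: z => [a b]; rewrite /real_part /= mul0r subr0. Qed.

Lemma real_part_real r : real_part r%:C%C = r.
Proof. by []. Qed.

Lemma real_part_imaginary r : real_part ('i%C * r%:C%C) = 0.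
Proof. by rewrite /real_part /= mul0r mul1r subr0. Qed.

Lemma le_real_part_modulus z : `|real_part z| <= modulus z.
Proof. by have := normc_ge_Re z; rewrite modulusE lecR. Qed.

Lemma modulus_sqr z : modulus z ^+ 2 = real_part z ^+ 2 + complex.Im z ^+ 2.
Proof.
by case: z => a b; rewrite /modulus /= sqr_sqrtr ?addr_ge0 ?sqr_ge0.
Qed.

Lemma real_partV z : real_part z^-1 = real_part z / modulus z ^+ 2.
Proof. by rewrite modulus_sqr; case: z. Qed.

End Modulus.

Section ContinuousModulus.
Context {R : realType} {X : topologicalType}.
Implicit Types (f : X -> cplx R).

Lemma near_modulus {f} {x : X} {e : R} : continuous f -> 0 < e ->
  \forall y \near x, modulus (f x - f y) < e.
Proof.
move=> cf e0; have e0' : (0 : cplx R) < e%:C%C by rewrite ltcR.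
have /cvgrPdist_lt /(_ _ e0') := cf x.
by apply: filterS => y; rewrite modulusE ltcR.
Qed.

Lemma continuous_modulus f : continuous f -> continuous (modulus \o f).
Proof.
move=> cf x; apply/cvgrPdist_lt => e e0.
apply: filterS (near_modulus cf e0) => y /= H.
apply: le_lt_trans H; rewrite ler_norml; apply/andP; split.
  rewrite lerNl opprB lerBlDr modulus_distC -[X in modulus X <= _](subrK (f x)).
  exact: modulusD.
by rewrite lerBlDr -{1}[f x](subrK (f y)); exact: modulusD.
Qed.

Lemma continuous_real_part f : continuous f -> continuous (real_part \o f).
Proof.
move=> cf x; apply/cvgrPdist_lt => e e0.
apply: filterS (near_modulus cf e0) => y /= H.
apply: le_lt_trans H; rewrite -real_partN -real_partD.
exact: le_real_part_modulus.
Qed.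

Lemma compact_modulus_bounded f : compact [set: X] -> continuous f ->
  exists2 M : R, 0 < M & forall x, modulus (f x) <= M.
Proof.
move=> cX cf; have [[x0 _]|nX] := pselect ([set: X] !=set0); last first.
  by exists 1 => // x; case: nX; exists x.
have [||c _ cmax] := @compact_EVT_max X R (modulus \o f) setT _ cX.
- by exists x0.
- by apply: continuous_subspaceT; exact: continuous_modulus.
exists (modulus (f c) + 1) => [|x].
  by rewrite ltr_wpDl ?modulus_ge0.
by rewrite (le_trans (cmax x _)) ?in_setT// lerDl.
Qed.

Lemma nbhs_preimage_open (Y : topologicalType) (g : X -> Y) (U : set Y) x :
  continuous g -> open U -> U (g x) -> nbhs x (g @^-1` U).
Proof. by move=> cg oU Ux; apply: cg; exact: open_nbhs_nbhs. Qed.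

End ContinuousModulus.

Lemma exp_lt_eps {R : realType} (r e : R) :
  0 <= r -> r < 1 -> 0 < e -> exists n, r ^+ n < e.
Proof.
move=> r0 r1 e0; have h : `|r| < 1 by rewrite ger0_norm.
have /cvgrPdist_lt/(_ e e0)[N _ /(_ N (leqnn _))] := cvg_expr h.
by rewrite /= sub0r normrN ger0_norm ?exprn_ge0//; exists N.
Qed.

(** * Algebras closed under uniform convergence on a set *)

(** Convergence is controlled on [Y] only, so that membership in [B] does not
    depend on the values off [Y]. *)
Record uniformly_closed_algebra {R : realType} {X : Type} (Y : set X)
    (B : set (X -> cplx R)) : Prop := UniformlyClosedAlgebra {
  uca_cst : forall c : cplx R, B (cst c);
  uca_add : forall f g, B f -> B g -> B (f \+ g);
  uca_mul : forall f g, B f -> B g -> B (f \* g);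
  uca_lim : forall f, (forall e : R, 0 < e ->
    exists2 g, B g & forall x, Y x -> modulus (f x - g x) <= e) -> B f }.

Section UniformlyClosedAlgebra.
Context {R : realType} {X : Type} {Y : set X} {B : set (X -> cplx R)}.
Hypothesis algB : uniformly_closed_algebra Y B.
Implicit Types (f g a b : X -> cplx R).

Lemma uca_eq f g : (forall x, Y x -> f x = g x) -> B f -> B g.
Proof.
move=> fg Bf; apply: (uca_lim algB) => e e0; exists f => // x Yx.
by rewrite fg// subrr modulus0 ltW.
Qed.

Lemma uca_scale (c : cplx R) f : B f -> B (fun x => c * f x).
Proof. by move=> Bf; exact: (uca_mul algB (uca_cst algB c) Bf). Qed.

Lemma uca_sub f g : B f -> B g -> B (f \- g).
Proof.
move=> Bf Bg.
have -> : f \- g = f \+ (fun x => -1 * g x).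
  by apply/funext => x /=; rewrite mulN1r.
exact: (uca_add algB Bf (uca_scale _ Bg)).
Qed.

Lemma uca_exp f n : B f -> B (fun x => f x ^+ n).
Proof.
move=> Bf; elim: n => [|n IH].
  by apply: uca_eq (uca_cst algB 1) => x _; rewrite expr0.
by apply: uca_eq (uca_mul algB Bf IH) => x _ /=; rewrite exprS.
Qed.

(** The partial sums [S n] of the Neumann series satisfy
    [1 / b - S n = (1 - b) ^ n / b], and [b] is at least [1 / 2] in modulus. *)
Lemma uca_inv_near1 b : B b -> (forall x, Y x -> modulus (1 - b x) <= 2^-1) ->
  B (fun x => (b x)^-1).
Proof.
move=> Bb b1; apply: (uca_lim algB) => e e0.
pose S n x : cplx R := \sum_(i < n) (1 - b x) ^+ i.
have BS n : B (S n).
  elim: n => [|n IH].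
    by apply: uca_eq (uca_cst algB 0) => x _; rewrite /S big_ord0.
  apply: uca_eq (uca_add algB IH
    (uca_exp n (uca_sub (uca_cst algB 1) Bb))) => x _ /=.
  by rewrite /S big_ord_recr.
have [|||n ne] := @exp_lt_eps R 2^-1 (e / 2); try by lra.
exists (S n) => // x Yx.
have bx2 : 2^-1 <= modulus (b x).
  have := modulusD (1 - b x) (b x); rewrite subrK modulus1.
  have := b1 x Yx; lra.
have bx0 : b x != 0.
  by apply: contraTneq bx2 => ->; rewrite modulus0 -ltNge invr_gt0.
have -> : (b x)^-1 - S n x = (1 - b x) ^+ n * (b x)^-1.
  apply: (mulIf bx0); rewrite mulrBl mulfVK// mulVf//.
  have := subrX1 (1 - b x) n; rewrite -/(S n x).
  rewrite (_ : 1 - b x - 1 = - b x); last by ring.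
  by move=> H; rewrite -[RHS](subrK 1) H; ring.
rewrite modulusM modulusX modulusV.
have h1 : modulus (1 - b x) ^+ n <= 2^-1 ^+ n.
  by rewrite lerXn2r ?nnegrE ?modulus_ge0 ?b1 ?invr_ge0.
have h2 : (modulus (b x))^-1 <= 2.
  by rewrite -[leRHS]invrK lef_pV2 ?posrE// (lt_le_trans _ bx2).
apply: (@le_trans _ _ (2^-1 ^+ n * 2)); last by lra.
by apply: ler_pM; rewrite ?exprn_ge0 ?modulus_ge0 ?invr_ge0 ?modulus_ge0.
Qed.

(** The form in which invertibility propagates: nearness to an invertible
    function is measured relative to the size of its inverse. *)
Lemma uca_inv_near a b : B (fun x => (a x)^-1) -> B b ->
  (forall x, Y x -> a x != 0) ->
  (forall x, Y x -> modulus (1 - (a x)^-1 * b x) <= 2^-1) ->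
  B (fun x => (b x)^-1).
Proof.
move=> Ba Bb a0 ab; have Bab := uca_mul algB Ba Bb.
apply: uca_eq (uca_mul algB Ba (uca_inv_near1 Bab ab)) => x Yx /=.
by rewrite invfM invrK mulrA mulVf ?a0// mul1r.
Qed.

(** The pole of [1 / (b - i t)] slides down the imaginary axis, in steps short
    enough for the Neumann series, from a point far away where [b] is a small
    perturbation of the constant [- i t]. *)
Lemma uca_inv_off_axis b (M d : R) : B b -> 0 < d ->
  (forall x, Y x -> modulus (b x) <= M) ->
  (forall x, Y x -> d <= `|real_part (b x)|) ->
  B (fun x => (b x)^-1).
Proof.
move=> Bb d0 bM bd; pose M1 := Num.max M 1.
have M10 : 0 < M1 by rewrite lt_max ltr01 orbT.
have bM1 x : Y x -> modulus (b x) <= M1 by move=> Yx; rewrite le_max bM.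
(* The inverse of b - i t is at most 1 / d in modulus on Y, so a step of d / 2
   changes b - i t by at most half of its modulus. *)
pose t k : R := k%:R * (d / 2).
pose bt k x : cplx R := b x - 'i%C * (t k)%:C%C.
have Bbt k : B (bt k) := uca_sub Bb (uca_cst algB _).
have bt_ge k x : Y x -> d <= modulus (bt k x).
  move=> Yx; apply: le_trans (le_real_part_modulus _).
  by rewrite real_partD real_partN real_part_imaginary oppr0 addr0 bd.
have bt0 k x : Y x -> bt k x != 0.
  move=> Yx; apply: contraTneq (bt_ge k x Yx) => ->.
  by rewrite modulus0 -ltNge.
have down k : B (fun x => (bt k.+1 x)^-1) -> B (fun x => (bt k x)^-1).
  move=> Bk; apply: (uca_inv_near Bk (Bbt k)) => x Yx; first exact: bt0.
  have -> : 1 - (bt k.+1 x)^-1 * bt k x =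
      (bt k.+1 x)^-1 * - ('i%C * (d / 2)%:C%C).
    apply: (mulfI (bt0 k.+1 x Yx)); rewrite mulrBr !mulVKf ?bt0// mulr1.
    rewrite /bt /t -natr1 mulrDl mul1r rmorphD /=; ring.
  rewrite modulusM modulusN modulusV modulus_imaginary.
  rewrite ger0_norm; last by lra.
  rewrite mulrC ler_pdivrMr; last by rewrite (lt_le_trans d0) ?bt_ge.
  have := bt_ge k.+1 x Yx; lra.
have [k kM] : exists k, 2 * M1 <= t k.
  exists (Num.bound (2 * M1 / (d / 2))); rewrite /t -ler_pdivrMr; last by lra.
  apply/ltW/archi_boundP; rewrite divr_ge0//; last by lra.
  by rewrite mulr_ge0// ltW.
have tk0 : 0 < t k by lra.
have it0 : 'i%C * (t k)%:C%C != 0 :> cplx R.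
  apply/eqP => /(congr1 modulus); rewrite modulus_imaginary modulus0.
  by rewrite gtr0_norm//; lra.
have far : B (fun x => (bt k x)^-1).
  apply: (uca_inv_near (a := cst (- ('i%C * (t k)%:C%C))) _ (Bbt k)).
  - exact: (uca_cst algB).
  - by move=> x _ /=; rewrite oppr_eq0.
  move=> x Yx /=.
  have -> : 1 - (- ('i%C * (t k)%:C%C))^-1 * bt k x =
      ('i%C * (t k)%:C%C)^-1 * b x.
    apply: (mulfI it0); rewrite invrN mulNr opprK mulrDr mulr1 !mulVKf//.
    by rewrite /bt; ring.
  rewrite modulusM modulusV modulus_imaginary gtr0_norm// mulrC ler_pdivrMr//.
  have := bM1 x Yx; lra.
have all0 : B (fun x => (bt 0%N x)^-1).
  by elim: k far {kM tk0 it0} => // k IH /down /IH.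
apply: uca_eq all0 => x _.
by rewrite /bt /t mul0r mulr0 subr0.
Qed.

End UniformlyClosedAlgebra.

(** * Splitting a function along a vertical strip *)

Section Newton.
Context {R : realType} {X : Type} {Y : set X} {B : set (X -> cplx R)}.
Hypothesis algB : uniformly_closed_algebra Y B.
Implicit Types (b : X -> cplx R).

Fixpoint newton (w : cplx R) n : cplx R :=
  if n is m.+1 then 2^-1 * (newton w m + (newton w m)^-1) else w.

Lemma real_part_newton_step (w : cplx R) :
  real_part (2^-1 * (w + w^-1)) =
  2^-1 * (1 + (modulus w ^+ 2)^-1) * real_part w.
Proof.
have -> : 2^-1 = (2^-1 : R)%:C%C :> cplx R by rewrite fmorphV/= rmorph_nat.
by rewrite real_partZ real_partD real_partV; ring.
Qed.

(** A Newton step multiplies the real part by at least [1 / 2], so that all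
    iterates stay uniformly off the imaginary axis and hence invertible in
    [B]. *)
Lemma newton_off_axis b (M d : R) n : B b -> 0 < d ->
  (forall x, Y x -> modulus (b x) <= M) ->
  (forall x, Y x -> d <= `|real_part (b x)|) ->
  [/\ B (fun x => newton (b x) n),
      exists M', forall x, Y x -> modulus (newton (b x) n) <= M' &
      exists2 d', 0 < d' & forall x, Y x ->
        d' <= `|real_part (newton (b x) n)|].
Proof.
move=> Bb d0 bM bd; elim: n => [|n [Bn [M' nM'] [d' d'0 nd']]] /=.
  by split=> //; [exists M | exists d].
have n_ge x : Y x -> d' <= modulus (newton (b x) n).
  by move=> Yx; rewrite (le_trans (nd' x Yx)) ?le_real_part_modulus.
split.
- apply: (uca_scale algB); apply: (uca_add algB) => //.
  exact: uca_inv_off_axis d'0 nM' nd'.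
- exists (2^-1 * (M' + d'^-1)) => x Yx; rewrite modulusM.
  have -> : modulus (2^-1 : cplx R) = 2^-1.
    by rewrite modulusV -[2](rmorph_nat (real_complex R)) modulus_real ger0_norm.
  rewrite ler_pM2l ?invr_gt0//; apply: le_trans (modulusD _ _) _.
  apply: lerD; first exact: nM'.
  by rewrite modulusV lef_pV2 ?posrE ?n_ge// (lt_le_trans d'0) ?n_ge.
- exists (2^-1 * d'); first by rewrite mulr_gt0 ?invr_gt0.
  move=> x Yx; rewrite real_part_newton_step normrM.
  apply: ler_pM; rewrite ?invr_ge0 ?(ltW d'0) ?nd'//.
  rewrite ger0_norm; last first.
    by rewrite mulr_ge0 ?invr_ge0// addr_ge0 ?invr_ge0 ?sqr_ge0.
  by rewrite ler_peMr ?invr_ge0// lerDl invr_ge0 sqr_ge0.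
Qed.

(** The Cayley transform [(w - s) / (w + s)] conjugates a Newton step to
    squaring, hence the geometric rate. *)
Lemma newton_cayley (w s rho : cplx R) n : s ^+ 2 = 1 ->
  (forall m, newton w m != 0) ->
  modulus (w - s) <= modulus rho * modulus (w + s) -> modulus rho <= 1 ->
  modulus (newton w n - s) <= modulus rho ^+ n.+1 * modulus (newton w n + s).
Proof.
move=> s2 w0 wrho rho1; elim: n => [|n IH] /=; first by rewrite expr1.
set v := newton w n in IH *; have v0 : v != 0 by exact: w0.
have sqr (t : cplx R) : t ^+ 2 = 1 ->
    2^-1 * (v + v^-1) - t = (2 * v)^-1 * (v - t) ^+ 2.
  by move=> t2; rewrite sqrrB t2; field.
have -> := sqr s s2.
have -> : 2^-1 * (v + v^-1) + s = (2 * v)^-1 * (v + s) ^+ 2.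
  by rewrite -[s]opprK sqr ?sqrrN.
rewrite !(modulusM (2 * v)^-1) (mulrCA _ (modulus (2 * v)^-1)).
rewrite ler_wpM2l ?modulus_ge0// !modulusX.
apply: (@le_trans _ _ ((modulus rho ^+ n.+1 * modulus (v + s)) ^+ 2)).
  by rewrite lerXn2r ?nnegrE ?mulr_ge0 ?exprn_ge0 ?modulus_ge0.
rewrite exprMn ler_wpM2r ?exprn_ge0 ?modulus_ge0// -exprM.
by rewrite ler_wiXn2l ?modulus_ge0// muln2 -addnn addSn !ltnS leq_addl.
Qed.

(** [|w + s| ^ 2 - |w - s| ^ 2 = 4 |Re w|], to be compared with the bound
    [(M + 1) ^ 2] of [|w + s| ^ 2]. *)
Lemma cayley_contraction (w s : cplx R) (M d : R) :
  s = 1 /\ d <= real_part w \/ s = -1 /\ real_part w <= - d ->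
  0 < d -> d <= M -> modulus w <= M ->
  modulus (w - s) <= (1 - 2 * (d / (M + 1) ^+ 2)) * modulus (w + s).
Proof.
move=> ws d0 dM wM; have M10 : 0 < (M + 1) ^+ 2 by rewrite exprn_gt0//; lra.
set k := d / _; have kM : k * (M + 1) ^+ 2 = d by rewrite mulfVK ?gt_eqF.
have k0 : 0 < k by rewrite divr_gt0.
have k1 : k <= 2^-1 by rewrite ler_pdivrMr// expr2; nra.
have s1 : modulus s = 1.
  by case: ws => -[-> _]; rewrite ?modulusN modulus1.
have diff : modulus (w - s) ^+ 2 + 4 * d <= modulus (w + s) ^+ 2.
  rewrite !modulus_sqr !real_partD real_partN.
  case: ws => -[-> wd]; rewrite ?opprK.
    case: w wd {wM} => a c; rewrite /real_part /= => wd.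
    by rewrite oppr0 addr0; nra.
  case: w wd {wM} => a c; rewrite /real_part /= => wd.
  by rewrite oppr0 addr0; nra.
have wsM : modulus (w + s) ^+ 2 <= (M + 1) ^+ 2.
  rewrite lerXn2r ?nnegrE ?modulus_ge0//; first by lra.
  by apply: le_trans (modulusD _ _) _; rewrite s1; lra.
have r0 : 0 <= 1 - 2 * k by lra.
rewrite -(ler_pXn2r (ltn0Sn 1)) ?nnegrE ?mulr_ge0 ?modulus_ge0//.
rewrite exprMn; set P := modulus (w + s) ^+ 2 in diff wsM *.
have P0 : 0 <= P by rewrite exprn_ge0 ?modulus_ge0.
have : 0 <= 4 * k ^+ 2 * P by rewrite mulr_ge0// mulr_ge0// sqr_ge0.
have : k * P <= d by rewrite -kM ler_wpM2l// ltW.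
nra.
Qed.

(** Newton's iteration for the square roots of [1] converges to [1] on the
    right half-plane and to [- 1] on the left one, uniformly on bounded sets
    away from the imaginary axis. All the inverses it takes are of functions
    that stay off this axis. *)
Lemma uca_half_plane_indicator b (M d : R) : B b -> 0 < d ->
  (forall x, Y x -> modulus (b x) <= M) ->
  (forall x, Y x -> d <= `|real_part (b x)|) ->
  B (fun x => if 0 < real_part (b x) then 1 else 0).
Proof.
move=> Bb d0 bM bd; apply: (uca_lim algB) => e e0.
pose M1 := Num.max M d; have dM1 : d <= M1 by rewrite le_max lexx orbT.
have bM1 x : Y x -> modulus (b x) <= M1 by move=> Yx; rewrite le_max bM.
pose rho := 1 - 2 * (d / (M1 + 1) ^+ 2).
have M10 : 0 < (M1 + 1) ^+ 2 by rewrite exprn_gt0//; lra.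
have rho1 : rho < 1 by rewrite gtrBl mulr_gt0// divr_gt0.
have rho0 : 0 <= rho.
  have : d / (M1 + 1) ^+ 2 <= 2^-1 by rewrite ler_pdivrMr//; nra.
  rewrite /rho; lra.
have [n [n1 n2]] : exists n, rho ^+ n.+1 < 2^-1 /\ rho ^+ n.+1 < e / 2.
  have [|N] := exp_lt_eps rho0 rho1 (e := Num.min 2^-1 (e / 2)).
    by rewrite lt_min; apply/andP; split; lra.
  rewrite lt_min => /andP[N1 N2].
  have NN : rho ^+ N.+1 <= rho ^+ N.
    by rewrite exprS ler_piMl ?exprn_ge0// ltW.
  by exists N; split; exact: le_lt_trans NN _.
have [Bn _ _] := newton_off_axis n Bb d0 bM bd.
exists (fun x => 2^-1 * (newton (b x) n + 1)).
  by apply: (uca_scale algB); apply: (uca_add algB) => //; exact: (uca_cst algB).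
move=> x Yx; pose s : cplx R := if 0 < real_part (b x) then 1 else -1.
have -> : (if 0 < real_part (b x) then 1 else 0) - 2^-1 * (newton (b x) n + 1)
    = - (2^-1 * (newton (b x) n - s)) by rewrite /s; case: ifP => _; field.
have newton0 m : newton (b x) m != 0.
  have [_ _ [d' d'0 /(_ x Yx)]] := newton_off_axis m Bb d0 bM bd.
  apply: contraTneq => ->.
  by rewrite (_ : real_part 0 = 0)// normr0 -ltNge.
have s2 : s ^+ 2 = 1 by rewrite /s; case: ifP => _; rewrite ?sqrrN expr1n.
have s1 : modulus s = 1 by rewrite /s; case: ifP => _; rewrite ?modulusN modulus1.
have mrho : modulus (rho%:C%C : cplx R) = rho by rewrite modulus_real ger0_norm.
have := @newton_cayley (b x) s rho%:C%C n s2 newton0; rewrite mrho => H.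
have {}H : modulus (newton (b x) n - s) <=
    rho ^+ n.+1 * modulus (newton (b x) n + s).
  apply: H; last exact: ltW.
  apply: cayley_contraction => //; last exact: bM1.
  have := bd x Yx; rewrite /s; case: ltP => re0.
    by rewrite gtr0_norm//; left.
  by rewrite ler0_norm// => ?; right; split=> //; lra.
rewrite modulusN modulusM.
have -> : modulus (2^-1 : cplx R) = 2^-1.
  by rewrite modulusV -[2](rmorph_nat (real_complex R)) modulus_real ger0_norm.
have : modulus (newton (b x) n + s) <= modulus (newton (b x) n - s) + 2.
  rewrite (_ : newton (b x) n + s = (newton (b x) n - s) + (s + s)); last by ring.
  apply: le_trans (modulusD _ _) _; rewrite lerD2l.
  by apply: le_trans (modulusD _ _) _; rewrite s1.
have := modulus_ge0 (newton (b x) n - s).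
have : 0 <= rho ^+ n.+1 by rewrite exprn_ge0.
move: H; set D := modulus (_ - s); set S := modulus (_ + s); set r := rho ^+ _.
move=> DS r0 D0 SD.
have : D <= r * (D + 2) by rewrite (le_trans DS)// ler_wpM2l.
have : r * D <= 2^-1 * D by rewrite ler_wpM2r// ltW.
by rewrite -/r in n1 n2 *; lra.
Qed.

End Newton.

Section Splitting.
Context {R : realType} {X : Type} {A : set (X -> cplx R)}.
Hypothesis algA : uniformly_closed_algebra setT A.
Hypothesis bndA : forall f, A f ->
  exists2 M : R, 0 < M & forall x, modulus (f x) <= M.

(** Multiplying the functions of [A] that vanish on [S] makes convergence off
    [S] sufficient for a closed algebra. So inverses of functions with zeros in
    [S] become available, and so do functions that jump across [S]. *)
Definition multipliers (S : set X) : set (X -> cplx R) :=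
  [set h | forall u, A u -> (forall x, S x -> u x = 0) -> A (u \* h)].

Lemma multipliers_uniformly_closed (S : set X) :
  uniformly_closed_algebra (~` S) (multipliers S).
Proof.
split.
- by move=> c u Au _; apply: (uca_mul algA Au); exact: (uca_cst algA).
- move=> f g Bf Bg u Au u0.
  apply: (uca_eq algA) (uca_add algA (Bf u Au u0) (Bg u Au u0)) => x _ /=.
  by rewrite mulrDr.
- move=> f g Bf Bg u Au u0.
  have ufS x : S x -> (u \* f) x = 0 by move=> Sx; rewrite /= u0// mul0r.
  apply: (uca_eq algA) (Bg _ (Bf u Au u0) ufS) => x _ /=.
  by rewrite mulrA.
move=> f fB u Au u0; apply: (uca_lim algA) => e e0.
have [M M0 uM] := bndA Au; have [|g Bg fg] := fB (e / M).
  exact: divr_gt0.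
exists (u \* g); first exact: Bg.
move=> x _ /=; rewrite -mulrBr modulusM.
have [Sx|nSx] := pselect (S x); first by rewrite u0// modulus0 mul0r ltW.
rewrite -[leRHS](divfK (lt0r_neq0 M0)) mulrC.
by apply: ler_pM; rewrite ?modulus_ge0// fg.
Qed.

(** A form of Runge's theorem, or of Shilov's idempotent theorem: the
    half-planes on both sides of the strip carry complementary idempotents in
    the closed algebra of multipliers of the ideal of the strip. *)
Lemma split_along_strip q u (r d : R) : A q -> A u -> 0 < d ->
  (forall x, `|real_part (q x) - r| < d -> u x = 0) ->
  A (fun x => if r < real_part (q x) then u x else 0).
Proof.
move=> Aq Au d0 u0; pose S := [set x | `|real_part (q x) - r| < d].
have algB := multipliers_uniformly_closed S.
pose b x : cplx R := q x - r%:C%C.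
have Ab : A b := uca_sub algA Aq (uca_cst algA _).
have Bb : multipliers S b by move=> v Av _; exact: (uca_mul algA).
have [M _ bM] := bndA Ab.
have rpb x : real_part (b x) = real_part (q x) - r.
  by rewrite real_partD real_partN real_part_real.
have off x : (~` S) x -> d <= `|real_part (b x)|.
  by rewrite /S /= rpb => /negP; rewrite -leNgt.
have ind := uca_half_plane_indicator algB Bb d0 (fun x _ => bM x) off.
apply: (uca_eq algA) (ind u Au u0) => x _ /=; rewrite rpb subr_gt0.
by case: ifP => _; rewrite ?mulr1 ?mulr0.
Qed.

End Splitting.

(** * Uniform algebras and their maximal ideals *)

Section UniformAlgebra.
Context {R : realType} {X : topologicalType}.
Implicit Types (f g : X -> cplx R).

Lemma modulus_le_uniform_norm f (M : R) x : (forall y, modulus (f y) <= M) ->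
  modulus (f x) <= uniform_norm f.
Proof.
move=> fM; apply: ub_le_sup; last by exists x.
by exists M => _ [y _ <-]; exact: fM.
Qed.

Lemma uniform_norm_le f (e : R) : 0 <= e -> (forall x, modulus (f x) <= e) ->
  uniform_norm f <= e.
Proof.
move=> e0 fe; rewrite /uniform_norm.
have [->|/set0P S0] := eqVneq (range (fun x => ComplexField.Normc.normc (f x))) set0.
  by rewrite sup0.
by apply: ge_sup => // _ [x _ <-]; exact: fe.
Qed.

Context {A : set (X -> cplx R)}.
Hypothesis cX : compact [set: X].
Hypothesis uA : uniform_algebra A.

Lemma uniform_algebra_function_algebra : function_algebra A.
Proof. by case: uA. Qed.

Lemma uniform_algebra_bounded f : A f ->
  exists2 M : R, 0 < M & forall x, modulus (f x) <= M.
Proof.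
move=> Af; apply: compact_modulus_bounded => //.
exact: fa_continuous uniform_algebra_function_algebra f Af.
Qed.

(** Completeness yields a limit in the norm; it is the given uniform limit
    because the norm dominates point evaluations. *)
Lemma uniform_algebra_closed : uniformly_closed_algebra setT A.
Proof.
have fA := uniform_algebra_function_algebra.
split; [exact: fa_cst fA|exact: fa_add fA|exact: fa_mul fA|].
move=> f fA'; have fn n : exists g, A g /\
    forall x, modulus (f x - g x) <= (n.+1%:R : R)^-1.
  have [|g Ag fg] := fA' (n.+1%:R : R)^-1; first by rewrite invr_gt0.
  by exists g; split=> // x; exact: fg.
have {fn}[u uP] := choice fn.
have sub g h : A g -> A h -> A (g \- h).
  move=> Ag Ah; have -> : g \- h = g \+ (cst (-1) \* h).
    by apply/funext => x /=; rewrite mulN1r.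
  by apply: (fa_add fA) => //; apply: (fa_mul fA) => //; exact: (fa_cst fA).
have inv_small (e : R) : 0 < e -> exists N, forall n, (N <= n)%N ->
    (n.+1%:R : R)^-1 < e.
  move=> e0; exists (Num.bound e^-1) => n Nn.
  rewrite -[ltRHS]invrK ltf_pV2 ?posrE ?invr_gt0//.
  rewrite (lt_le_trans (archi_boundP _)) ?invr_ge0 ?(ltW e0)//.
  by rewrite ler_nat ltnW.
have [_ _ cA] := uA.
have [||h Ah uh] := cA u; first by move=> n; exact: (uP n).1.
  move=> e e0; have [|N HN] := inv_small (e / 3); first by rewrite divr_gt0.
  exists N => m n Nm Nn.
  have /HN m3 := Nm; have /HN n3 := Nn.
  apply: (@le_lt_trans _ _ (2 * (e / 3))); last by lra.
  apply: uniform_norm_le => [|x /=]; first by lra.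
  rewrite (_ : u m x - u n x = (f x - u n x) - (f x - u m x)); last by ring.
  apply: le_trans (modulusB _ _) _.
  apply: le_trans (lerD ((uP n).2 x) ((uP m).2 x)) _; move: m3 n3.
  by move: (m.+1%:R^-1 : R) (n.+1%:R^-1 : R) => s t; lra.
suff -> : f = h by [].
apply/funext => x; apply/eqP; rewrite -subr_eq0; apply/eqP.
apply: modulus_small => e e0.
have e20 : 0 < e / 2 by rewrite divr_gt0.
have [N1 _ H1] := (@cvgrPdist_lt _ _ _ _ _ _ _).1 uh _ e20.
have [N2 H2] := inv_small _ e20.
pose N := maxn N1 N2.
have {}H1 := H1 N (leq_maxl _ _); have {}H2 := H2 N (leq_maxr _ _).
have [M _ uhM] := uniform_algebra_bounded (sub _ _ (uP N).1 Ah).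
have H3 := modulus_le_uniform_norm x uhM; rewrite /= in H1 H3.
rewrite (_ : f x - h x = (f x - u N x) + (u N x - h x)); last by ring.
apply: le_trans (modulusD _ _) _; have := (uP N).2 x.
move: H1; rewrite sub0r normrN => /(le_lt_trans (ler_norm _)).
move: H2 H3; move: (N.+1%:R^-1 : R) (uniform_norm _) => s t.
by lra.
Qed.

End UniformAlgebra.

Record proper_ideal {R : realType} {X : Type} (A I : set (X -> cplx R)) : Prop :=
  ProperIdeal {
  pi_sub : I `<=` A;
  pi_zero : I (cst 0);
  pi_add : forall f g, I f -> I g -> I (f \+ g);
  pi_mul : forall f g, A f -> I g -> I (f \* g);
  pi_one : ~ I (cst 1) }.

(** Maximality is expressed by the quotient being a field, the form in which
    every argument uses it and which kernels of characters visibly satisfy. *)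
Record maximal_ideal {R : realType} {X : Type} (A I : set (X -> cplx R)) : Prop :=
  MaximalIdeal {
  mi_proper : proper_ideal A I;
  mi_inv : forall f, A f -> ~ I f -> exists2 p, A p & I (cst 1 \- f \* p) }.

Section MaximalIdeals.
Context {R : realType} {X : topologicalType} {A : set (X -> cplx R)}.
Hypothesis cX : compact [set: X].
Hypothesis uA : uniform_algebra A.
Implicit Types (f g h u p q : X -> cplx R) (I : set (X -> cplx R)).

Let algA := uniform_algebra_closed cX uA.
Let bndA := uniform_algebra_bounded cX uA.

Lemma pi_far_from_one I f : proper_ideal A I -> I f ->
  ~ (forall x, modulus (1 - f x) <= 2^-1).
Proof.
move=> pI If f1; have Af := pi_sub pI If.
have Af' := uca_inv_near1 algA Af (fun x _ => f1 x).
apply: (pi_one pI); have := pi_mul pI Af' If; congr (I _).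
apply/funext => x /=; rewrite mulVf//; apply: contraTneq (f1 x) => ->.
by rewrite subr0 modulus1 -ltNge invf_lt1 ?ltr1n.
Qed.

Lemma maximal_ideal_prime I f g : maximal_ideal A I -> A f -> A g ->
  ~ I f -> ~ I g -> ~ I (f \* g).
Proof.
move=> mI Af Ag nIf nIg Ifg; have pI := mi_proper mI.
have [p Ap Ip] := mi_inv mI Af nIf; apply: nIg.
have := pi_add pI (pi_mul pI Ag Ip) (pi_mul pI Ap Ifg); congr (I _).
by apply/funext => x /=; ring.
Qed.

(** If [f] were outside [I], then [1 - f p] would be in [I] for some [p], and
    replacing [f] by a nearby element of [I] would put a function close to [1],
    hence invertible in [A], into [I]. *)
Lemma maximal_ideal_closed I f : maximal_ideal A I -> A f ->
  (forall e : R, 0 < e -> exists2 g, I g & forall x, modulus (f x - g x) <= e) ->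
  I f.
Proof.
move=> mI Af fI; apply: contrapT => nIf; have pI := mi_proper mI.
have [p Ap Ip] := mi_inv mI Af nIf.
have [M M0 pM] := bndA Ap; have [|g Ig fg] := fI (2^-1 / M).
  by rewrite divr_gt0 ?invr_gt0.
apply: (pi_far_from_one pI (pi_add pI Ip (pi_mul pI Ap Ig))) => x /=.
rewrite (_ : 1 - _ = p x * (f x - g x)); last by ring.
rewrite modulusM -[leRHS](divfK (lt0r_neq0 M0)) mulrC.
by apply: ler_pM; rewrite ?modulus_ge0.
Qed.

Lemma sub_maximal_ideal I J : maximal_ideal A I -> proper_ideal A J ->
  I `<=` J -> I = J.
Proof.
move=> mI pJ IJ; apply/seteqP; split=> // f Jf; apply: contrapT => nIf.
have [p Ap Ip] := mi_inv mI (pi_sub pJ Jf) nIf; apply: (pi_one pJ).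
have := pi_add pJ (IJ _ Ip) (pi_mul pJ Ap Jf); congr (J _).
by apply/funext => x /=; ring.
Qed.

Lemma exists_maximal_ideal J : proper_ideal A J ->
  exists2 I, maximal_ideal A I & J `<=` I.
Proof.
move=> pJ; pose P := [set I | proper_ideal A I /\ J `<=` I \/ I = set0].
(* The empty set is admitted because it is the union of the empty chain. *)
have [F FP Ftot|I [PI Imax]] := @Zorn_bigcup _ P.
  have [[I0 [FI0 I00]]|nF] := pselect (exists I0, F I0 /\ I0 <> set0); last first.
    right; apply/seteqP; split=> // f [I FI If]; apply: nF; exists I; split=> //.
    by move=> I0; rewrite I0 in If.
  have FI I f : F I -> I f -> proper_ideal A I /\ J `<=` I.
    by move=> /FP[//|->].
  have [f0 I0f0] : I0 !=set0 by apply/set0P/eqP.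
  have [pI0 JI0] := FI _ _ FI0 I0f0.
  left; split; last by move=> f /JI0 I0f; exists I0.
  split.
  - by move=> f [I FI' If]; exact: pi_sub (FI _ _ FI' If).1 _ If.
  - by exists I0 => //; exact: pi_zero pI0.
  - move=> f g [I1 F1 If] [I2 F2 Ig].
    have [I12|I21] := Ftot _ _ F1 F2.
      exists I2 => //; apply: (pi_add (FI _ _ F2 Ig).1) => //; exact: I12.
    exists I1 => //; apply: (pi_add (FI _ _ F1 If).1) => //; exact: I21.
  - move=> f g Af [I1 F1 Ig]; exists I1 => //.
    exact: (pi_mul (FI _ _ F1 Ig).1).
  - by move=> [I1 F1 I11]; exact: (pi_one (FI _ _ F1 I11).1).
have {PI}[pI JI] : proper_ideal A I /\ J `<=` I.
  case: PI => // I0; exfalso; apply: (Imax J); last by left; split=> // f.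
  by rewrite I0; split=> [f //|J0]; exact: J0 (pi_zero pJ).
exists I => //; split=> // f Af nIf; apply: contrapT => nex.
pose K := [set h | exists g p, [/\ I g, A p & h = g \+ f \* p]].
have IK : I `<=` K.
  move=> g Ig; exists g, (cst 0); split=> //; first exact: (uca_cst algA).
  by apply/funext => x /=; rewrite mulr0 addr0.
have Kf : K f.
  exists (cst 0), (cst 1); split; [exact: pi_zero pI|exact: (uca_cst algA)|].
  by apply/funext => x /=; rewrite add0r mulr1.
apply: (Imax K); first by split=> // KI; exact: nIf (KI _ Kf).
left; split; last by move=> g /JI/IK.
split; last 1 first.
- move=> [g [p [Ig Ap E]]]; apply: nex; exists p => //.
  have -> : cst 1 \- f \* p = g; last by [].
  by rewrite E; apply/funext => x /=; ring.
- move=> _ [g [p [Ig Ap ->]]]; apply: (uca_add algA); first exact: pi_sub Ig.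
  exact: (uca_mul algA).
- exact/IK/(pi_zero pI).
- move=> _ _ [g [p [Ig Ap ->]]] [h [q [Ih Aq ->]]].
  exists (g \+ h), (p \+ q); split; [exact: (pi_add pI)|exact: (uca_add algA)|].
  by apply/funext => x /=; ring.
- move=> h _ Ah [g [p [Ig Ap ->]]]; exists (h \* g), (h \* p).
  split; [exact: (pi_mul pI)|exact: (uca_mul algA)|].
  by apply/funext => x /=; ring.
Qed.

End MaximalIdeals.

(** * Compact sets mapping onto an interval *)

(** A closed subset of [T] that is minimal among those still mapping onto
    [[a, b]] is perfect: the image of what remains when an isolated point is
    removed is closed and misses at most one point of [[a, b]]. *)
Lemma perfect_subset_of_interval_preimage {R : realType} {X : topologicalType}
    (T : set X) (f : X -> R) (a b : R) :
  compact [set: X] -> closed T -> continuous f -> a < b ->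
  (forall c, a <= c <= b -> exists2 x, T x & f x = c) ->
  exists P, [/\ perfect_set P, P `<=` T & P !=set0].
Proof.
move=> cX clT cf ab Tab.
(* A minimal closed subset T \ U of T comes from a maximal open U. *)
pose Q := [set U : set X | open U /\
  forall c, a <= c <= b -> exists x, [/\ T x, ~ U x & f x = c]].
have [F FQ Ftot|U [[oU Uab] Umax]] := @Zorn_bigcup _ Q.
  split; first by apply: bigcup_open => U /FQ[].
  move=> c cab; have [[U0 FU0]|nF] := pselect (exists U, F U); last first.
    have [x Tx fx] := Tab c cab; exists x; split=> // -[U FU _].
    by apply: nF; exists U.
  pose K U := [set x | [/\ T x, ~ U x & f x = c]].
  have FF : ProperFilter (filter_from F K).
    apply: filter_from_proper; last by move=> U /FQ[_ /(_ c cab)].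
    apply: filter_from_filter; first by exists U0.
    move=> U V FU FV; have [UV|VU] := Ftot _ _ FU FV.
      by exists V => // x [Tx nV fx]; split; split=> // /UV.
    by exists U => // x [Tx nU fx]; split; split=> // /VU.
  have clK : closed (T `&` f @^-1` [set c]).
    apply: closedI => //; apply: preimage_closed; first by move=> x _; exact: cf.
    exact: closed_eq.
  have /(_ _ FF)[] := subclosed_compact clK cX (@subsetT _ _).
    by exists U0 => // x [].
  move=> x [[Tx fx] clx]; exists x; split=> // -[U FU Ux].
  have [||y [[_ nUy _] Uy]] := clx (K U) U; first by exists U.
    by apply: open_nbhs_nbhs; split=> //; exact: (FQ _ FU).1.
  exact: nUy.
pose P := T `&` ~` U; have clP : closed P by apply: closedI => //; exact: open_closedC.
have PT : P `<=` T by move=> x [].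
exists P; split=> //; last first.
  by have [|x [Tx nU _]] := Uab a; [rewrite lexx ltW|exists x].
apply/perfectP; split=> //; apply/seteqP; split=> // x [/set_mem[Tx nUx]].
move=> [V Vx VP]; pose W := interior V.
have WP y : W y -> P y -> y = x.
  move=> /interior_subset Vy Py.
  by have : [set x] y; [rewrite -VP|].
apply: (Umax (U `|` W)).
  split; first by move=> y; left.
  by move=> /(_ x (or_intror Vx)).
split; first by apply: openU => //; exact: open_interior.
pose Z := P `&` ~` W.
have Zne c : a <= c <= b -> c != f x -> (f @` Z) c.
  move=> cab cfx; have [y [Ty nUy fy]] := Uab c cab; exists y => //; split=> //.
  by move=> /WP/(_ (conj Ty nUy)) yx; rewrite -fy yx eqxx in cfx.
have clfZ : closed (f @` Z).
  apply: compact_closed; first exact: Rhausdorff.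
  apply: continuous_compact; first exact: continuous_subspaceT.
  apply: (subclosed_compact _ cX) => //; apply: closedI => //.
  by apply: open_closedC; exact: open_interior.
(* The value f x at the isolated point is a limit of other values c' in [a, b],
   which the closed image of Z contains. *)
suff Zall c : a <= c <= b -> (f @` Z) c.
  by move=> c /Zall[y [[Ty nUy] nWy] fy]; exists y; split=> // -[].
move=> cab; have [cfx|] := eqVneq c (f x); last exact: Zne.
apply: clfZ => /= N /nbhs_ballP[e /= e0 eN].
have [c' [c'ab c'c c'e]] : exists c', [/\ a <= c' <= b, c' != c & `|c - c'| < e].
  have /andP[ac cb] := cab.
  have [cltb|bc] := ltP c b.
    have [h|h] := leP b (c + e / 2); [exists b|exists (c + e / 2)]; split.
    - by apply/andP; split; lra.
    - by rewrite gt_eqF.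
    - by rewrite ler0_norm; lra.
    - by apply/andP; split; lra.
    - by rewrite gt_eqF//; lra.
    - by rewrite ler0_norm; lra.
  have [h|h] := leP (c - e / 2) a; [exists a|exists (c - e / 2)]; split.
  - by apply/andP; split; lra.
  - by rewrite lt_eqF//; lra.
  - by rewrite ger0_norm; lra.
  - by apply/andP; split; lra.
  - by rewrite lt_eqF//; lra.
  - by rewrite ger0_norm; lra.
exists c'; split; last exact: eN.
by apply: Zne => //; rewrite -cfx.
Qed.

(** * The carrier of a maximal ideal *)

(** It plays the role of the support of a representing measure when [I] is the
    kernel of a character: a function of [A] outside [I] vanishes on no
    neighbourhood of a carrier point. *)
Definition carrier {R : realType} {X : topologicalType}
  (A I : set (X -> cplx R)) : set X := [set y | local_ideal A y `<=` I].

Section Carrier.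
Context {R : realType} {X : topologicalType} {A : set (X -> cplx R)}.
Hypothesis cX : compact [set: X].
Hypothesis uA : uniform_algebra A.
Implicit Types (f g h u p q : X -> cplx R) (I : set (X -> cplx R)) (x y : X).

Let fA := uniform_algebra_function_algebra uA.
Let algA := uniform_algebra_closed cX uA.
Let bndA := uniform_algebra_bounded cX uA.

Lemma carrier_closed I : closed (carrier A I).
Proof.
move=> y cly f [Af /= f0]; have [z [cz fz]] := cly _ (nbhs_interior f0).
by apply: cz; split.
Qed.

(** If every element of [A] outside [I] had a nonzero value on [K], then, as
    [I] is prime, the sets of these nonzero values in [K] would generate a
    proper filter; none of its cluster points could lie outside the carrier. *)
Lemma carrier_disjoint_vanish I (K : set X) : maximal_ideal A I -> closed K ->
  K `&` carrier A I = set0 ->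
  exists u, [/\ A u, ~ I u & forall x, K x -> u x = 0].
Proof.
move=> mI clK KI; apply: contrapT => nu; have pI := mi_proper mI.
pose D := [set u | A u /\ ~ I u]; pose N u := [set x | K x /\ u x != 0].
have D1 : D (cst 1) by split; [exact: (uca_cst algA)|exact: pi_one pI].
have FF : ProperFilter (filter_from D N).
  apply: filter_from_proper; last first.
    move=> u [Au nIu]; apply: contrapT => N0; apply: nu; exists u; split=> // x Kx.
    by apply: contrapT => /eqP ux; apply: N0; exists x.
  apply: filter_from_filter; first by exists (cst 1).
  move=> f g [Af nIf] [Ag nIg]; exists (f \* g).
    by split; [exact: (uca_mul algA)|exact: (maximal_ideal_prime mI)].
  by move=> x [Kx /=]; rewrite mulf_eq0 negb_or => /andP[].
have [|y [Ky cly]] := subclosed_compact clK cX (@subsetT _ _) FF.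
  by exists (cst 1) => // x [].
have /existsNP[f /not_implyP[[Af f0] nIf]] : ~ carrier A I y.
  by move=> Iy; have : (K `&` carrier A I) y by []; rewrite KI.
have [|z [[_ /eqP nz]]] := cly (N f) _ _ f0; first by exists f.
by [].
Qed.

Lemma carrier_neq0 I : maximal_ideal A I -> carrier A I !=set0.
Proof.
move=> mI; apply: contrapT => /set0P/negP/negPn/eqP c0.
have [|u [Au nIu u0]] := carrier_disjoint_vanish mI closedT.
  by rewrite c0 setI0.
apply: nIu; have := pi_zero (mi_proper mI); congr (I _).
by apply/funext => x; rewrite u0.
Qed.

Lemma max_ideal_maximal x : maximal_ideal A (max_ideal A x).
Proof.
split; first split.
- by move=> f [].
- by split; first exact: (uca_cst algA).
- move=> f g [Af f0] [Ag g0]; split; first exact: (uca_add algA).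
  by rewrite /= f0 g0 addr0.
- move=> f g Af [Ag g0]; split; first exact: (uca_mul algA).
  by rewrite /= g0 mulr0.
- by move=> [_ /eqP]; rewrite /= oner_eq0.
move=> f Af nf; exists (cst (f x)^-1); first exact: (uca_cst algA).
have fx0 : f x != 0 by apply/eqP => f0; apply: nf.
split; last by rewrite /= mulfV// subrr.
apply: (uca_sub algA); first exact: (uca_cst algA).
by apply: (uca_mul algA) => //; exact: (uca_cst algA).
Qed.

(** [I] is closed, hence contains the closure [M_y] of [J_y]. *)
Lemma carrier_strongly_regular I y : maximal_ideal A I ->
  norm_closure A uniform_norm (local_ideal A y) = max_ideal A y ->
  carrier A I y -> I = max_ideal A y.
Proof.
move=> mI Ey Iy; apply/esym/(sub_maximal_ideal (max_ideal_maximal y)).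
  exact: mi_proper mI.
rewrite -Ey => f [Af fJ]; apply: (maximal_ideal_closed cX uA mI Af) => e e0.
have [g Jg fg] := fJ e e0; exists g; first exact: Iy.
have [M _ fgM] := bndA (uca_sub algA Af Jg.1).
by move=> x; apply: le_trans (modulus_le_uniform_norm x fgM) (ltW fg).
Qed.

Lemma max_ideal_inj x y : max_ideal A x = max_ideal A y -> x = y.
Proof.
move=> xy; apply: contrapT => /eqP /(fa_separates fA)[f Af].
apply/negP; rewrite negbK -subr_eq0; apply/eqP.
pose g := f \- cst (f y).
have : max_ideal A y g.
  by split; [exact: (uca_sub algA Af (uca_cst algA _))|rewrite /g /= subrr].
by rewrite -xy => -[].
Qed.

(** If the line [Re q = r] missed the carrier, some [u] outside [I] would vanish
    on a strip around it. But [I] contains [1_{Re q > r} u] and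
    [1_{Re q <= r} u], because these belong to [A] and vanish near a point of
    the carrier on the other side of the strip. *)
Lemma carrier_no_gap I q x y (r : R) : maximal_ideal A I -> A q ->
  carrier A I x -> carrier A I y -> real_part (q x) < r -> r < real_part (q y) ->
  exists2 z, carrier A I z & real_part (q z) = r.
Proof.
move=> mI Aq Ix Iy qx qy; apply: contrapT => nz; have pI := mi_proper mI.
have cq : continuous (real_part \o q).
  by apply: continuous_real_part; exact: fa_continuous fA q Aq.
have clT : closed ((real_part \o q) @` carrier A I).
  apply: compact_closed; first exact: Rhausdorff.
  apply: continuous_compact; first exact: continuous_subspaceT.
  exact: subclosed_compact (@carrier_closed I) cX (@subsetT _ _).
have [d d0 dT] : exists2 d : R, 0 < d &
    forall z, carrier A I z -> d < `|real_part (q z) - r|.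
  have /existsNP[N /not_implyP[/nbhs_ballP[d /= d0 dN] nN]] :
      ~ closure ((real_part \o q) @` carrier A I) r.
    by move/clT => -[z Iz qz]; apply: nz; exists z.
  exists (d / 2) => [|z Iz]; first by rewrite divr_gt0.
  rewrite ltNge; apply/negP => zd; apply: nN; exists (real_part (q z)).
  split; first by exists z.
  by apply: dN; rewrite /ball /= distrC (le_lt_trans zd)//; lra.
pose K := [set z | `|real_part (q z) - r| <= d].
have clK : closed K.
  apply: (@preimage_closed _ _ (fun z => `|real_part (q z) - r|) [set t | t <= d]).
    move=> z _; apply: (@continuous_comp _ _ _ (fun z => real_part (q z) - r)).
      by apply: continuousB; [exact: cq|exact: cvg_cst].
    exact: norm_continuous.
  exact: closed_le.
have [|u [Au nIu u0]] := carrier_disjoint_vanish mI clK.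
  by apply/seteqP; split=> // z [/= zK /dT]; rewrite ltNge zK.
pose v z := if r < real_part (q z) then u z else 0.
have Av : A v.
  apply: (split_along_strip algA bndA Aq Au d0) => z zd.
  by apply: u0; exact: ltW.
have Iv : I v.
  apply: Ix; split=> //.
  have : nbhs x ((real_part \o q) @^-1` [set t | t < r]).
    by apply: nbhs_preimage_open => //; exact: open_lt.
  by apply: filterS => z /= zr; rewrite /v ltNge ltW.
have Iuv : I (u \- v).
  apply: Iy; split; first exact: (uca_sub algA).
  have : nbhs y ((real_part \o q) @^-1` [set t | r < t]).
    by apply: nbhs_preimage_open => //; exact: open_gt.
  by apply: filterS => z /= zr; rewrite /v zr subrr.
apply: nIu; have := pi_add pI Iv Iuv; congr (I _).
by apply/funext => z /=; ring.
Qed.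

(** If [q] vanishes at [x] but is not in [I], then [q p = 1] modulo [I] for
    some [p], so that [u = (q p) ^ n u] modulo [I]. With [u] supported where
    [q p] is small, the right-hand side tends to [0]. *)
Lemma carrier_set1 I x : maximal_ideal A I -> carrier A I = [set x] ->
  I = max_ideal A x.
Proof.
move=> mI Ix; have pI := mi_proper mI.
apply/esym/(sub_maximal_ideal (max_ideal_maximal x) pI) => q [Aq q0].
apply: contrapT => nIq; have [p Ap Iqp] := mi_inv mI Aq nIq.
pose f := q \* p; have Af : A f := uca_mul algA Aq Ap.
pose K := [set z | 2^-1 <= modulus (f z)].
have clK : closed K.
  apply: (@preimage_closed _ _ (modulus \o f) [set t | 2^-1 <= t]).
    by move=> z _; apply: continuous_modulus; exact: fa_continuous fA f Af.
  exact: closed_ge.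
have [|u [Au nIu u0]] := carrier_disjoint_vanish mI clK.
  rewrite Ix; apply/seteqP; split=> // z [/= zK zx]; move: zK; rewrite /K /=.
  have -> : f z = 0 by rewrite (zx : z = x) /f /= q0 mul0r.
  by rewrite modulus0 leNgt invr_gt0 ltr0n.
apply: nIu; apply: (maximal_ideal_closed cX uA mI Au) => e e0.
have In n : I (fun z => u z - f z ^+ n * u z).
  elim: n => [|n IH].
    have := pi_zero pI; congr (I _).
    by apply/funext => z; rewrite expr0 mul1r subrr.
  have := pi_add pI IH (pi_mul pI (uca_mul algA (uca_exp algA n Af) Au) Iqp).
  by congr (I _); apply/funext => z /=; rewrite exprS /f /=; ring.
have [M M0 uM] := bndA Au.
have [|||n ne] := @exp_lt_eps R 2^-1 (e / M).
- by rewrite invr_ge0.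
- by rewrite invf_lt1 ?ltr1n.
- exact: divr_gt0.
exists (fun z => u z - f z ^+ n * u z) => // z.
rewrite opprB addrC subrK modulusM modulusX.
have [zK|zK] := leP 2^-1 (modulus (f z)).
  by rewrite u0// modulus0 mulr0 ltW.
rewrite -[leRHS](divfK (lt0r_neq0 M0)).
apply: ler_pM; rewrite ?exprn_ge0 ?modulus_ge0 ?uM//.
apply: le_trans (ltW ne).
by rewrite lerXn2r ?nnegrE ?modulus_ge0 ?invr_ge0// ltW.
Qed.

End Carrier.

(** * Carriers, characters and normality when the exceptional set is small *)

Section SmallExceptionalSet.
Context {R : realType} {X : topologicalType} {A : set (X -> cplx R)}.
Hypothesis cX : compact [set: X].
Hypothesis uA : uniform_algebra A.

Let fA := uniform_algebra_function_algebra uA.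
Let algA := uniform_algebra_closed cX uA.

Let E := [set x : X |
  norm_closure A uniform_norm (local_ideal A x) <> max_ideal A x].
Hypothesis noperfE : forall P : set X, perfect_set P -> P `<=` E -> P = set0.

Lemma separating_function x y : x != y ->
  exists q, [/\ A q, q x = 0 & q y = 1].
Proof.
move=> /(fa_separates fA)[g Ag gxy].
exists (fun z => (g y - g x)^-1 * (g z - g x)); split.
- apply: (uca_scale algA); apply: (uca_sub algA) => //; exact: (uca_cst algA).
- by rewrite subrr mulr0.
- by rewrite mulVf// subr_eq0 eq_sym.
Qed.

(** Two points of the carrier would make it map onto [[0, 1]]. A maximal ideal
    has at most one carrier point outside [E], hence some subinterval pulls
    back into [E]. *)
Lemma carrier_singleton I : maximal_ideal A I -> exists x, carrier A I = [set x].
Proof.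
move=> mI; have [x Ix] := carrier_neq0 cX uA mI; exists x.
apply/seteqP; split=> [y Iy|_ ->//]; apply: contrapT => /eqP; rewrite eq_sym => xy.
have [q [Aq qx qy]] := separating_function xy.
have qx0 : real_part (q x) = 0 by rewrite qx.
have {qx qy}qy1 : real_part (q y) = 1 by rewrite qy.
have cq : continuous (real_part \o q).
  by apply: continuous_real_part; exact: fa_continuous fA q Aq.
have onto c : 0 <= c <= 1 -> exists2 z, carrier A I z & real_part (q z) = c.
  rewrite le_eqVlt andb_orl => /orP[/andP[/eqP <- _]|]; first by exists x.
  rewrite le_eqVlt andb_orr => /orP[/andP[_ /eqP ->]|/andP[c0 c1]].
    by exists y.
  by apply: (carrier_no_gap cX uA mI Aq Ix Iy); rewrite ?qx0 ?qy1.
have [a [b [a0 ab b1 abE]]] : exists a b : R, [/\ 0 <= a, a < b, b <= 1 &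
    forall z, carrier A I z -> a <= real_part (q z) <= b -> E z].
  have [[w [Iw nEw]]|nw] := pselect (exists w, carrier A I w /\ ~ E w); last first.
    exists 0, 1; split=> // z Iz _; apply: contrapT => nEz; apply: nw.
    by exists z.
  have Iw' := carrier_strongly_regular cX uA mI (contrapT nEw) Iw.
  have uniq z : carrier A I z -> real_part (q z) <> real_part (q w) -> E z.
    move=> Iz zw; apply: contrapT => nEz; apply: zw.
    have := carrier_strongly_regular cX uA mI (contrapT nEz) Iz.
    by rewrite Iw' => /(max_ideal_inj cX uA) ->.
  have [wlt|wge] := ltP (real_part (q w)) 2^-1.
    exists 2^-1, 1; split=> [|||z Iz /andP[za zb]]; try lra.
    by apply: uniq => // zw; lra.
  exists 0, 3^-1; split=> [|||z Iz /andP[za zb]]; try lra.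
  by apply: uniq => // zw; lra.
pose T := carrier A I `&` (real_part \o q) @^-1` [set` `[a, b]].
have clT : closed T.
  apply: closedI; first exact: carrier_closed.
  by apply: preimage_closed; [move=> z _; exact: cq|exact: interval_closed].
have [|P [perfP PT P0]] :=
    perfect_subset_of_interval_preimage (f := real_part \o q) cX clT cq ab.
  move=> c /andP[ac cb]; have [|z Iz zc] := onto c; first by apply/andP; split; lra.
  by exists z => //; split=> //=; rewrite in_itv /= zc ac cb.
have PE : P `<=` E.
  by move=> z /PT[Iz /=]; rewrite in_itv /=; exact: abE.
by move: P0; rewrite (noperfE perfP PE) => -[].
Qed.

Lemma maximal_idealE I : maximal_ideal A I -> exists x,
  I = max_ideal A x /\ carrier A I = [set x].
Proof.
move=> mI; have [x Ix] := carrier_singleton mI.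
by exists x; split=> //; exact: (carrier_set1 cX uA).
Qed.

(** Normality on [X] asks that the ideals of the functions vanishing on [E1] and
    on [E2] sum to [A]. A maximal ideal above both would have its single carrier
    point in [E1] and in [E2]. *)
Lemma normal_on_base : normal_on A.
Proof.
move=> E1 E2 cl1 cl2 E12.
pose k (K : set X) := [set f | A f /\ forall x, K x -> f x = 0].
pose J := [set f | exists g h, [/\ k E1 g, k E2 h & f = g \+ h]].
have [J1|nJ1] := pselect (J (cst 1)).
  have [g [h [[Ag g0] [Ah h0] gh]]] := J1; exists g => //.
  split=> _ [x Ex <-] /=; first exact: g0.
  by have /(congr1 (fun f => f x)) := gh; rewrite /= h0// addr0.
have k0 K : k K (cst 0) by split=> //; exact: (uca_cst algA).
have pJ : proper_ideal A J.
  split=> //.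
  - by move=> _ [g [h [[Ag _] [Ah _] ->]]]; exact: (uca_add algA).
  - exists (cst 0), (cst 0); split; [exact: k0|exact: k0|].
    by apply/funext => x /=; rewrite addr0.
  - move=> _ _ [g [h [[Ag g0] [Ah h0] ->]]] [g' [h' [[Ag' g'0] [Ah' h'0] ->]]].
    exists (g \+ g'), (h \+ h'); split.
    + split; first exact: (uca_add algA).
      by move=> x Ex /=; rewrite g0// g'0// addr0.
    + split; first exact: (uca_add algA).
      by move=> x Ex /=; rewrite h0// h'0// addr0.
    + by apply/funext => x /=; ring.
  - move=> f _ Af [g [h [[Ag g0] [Ah h0] ->]]].
    exists (f \* g), (f \* h); split.
    + split; first exact: (uca_mul algA).
      by move=> x Ex /=; rewrite g0// mulr0.
    + split; first exact: (uca_mul algA).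
      by move=> x Ex /=; rewrite h0// mulr0.
    + by apply/funext => x /=; ring.
have [I mI JI] := exists_maximal_ideal cX uA pJ.
have [x Ix] := carrier_singleton mI.
have inK (K : set X) : closed K -> k K `<=` I -> K x.
  move=> clK KI; apply: contrapT => nKx.
  have [|u [Au nIu u0]] := carrier_disjoint_vanish cX uA mI clK.
    by rewrite Ix; apply/seteqP; split=> // z [Kz zx]; apply: nKx; rewrite -zx.
  by apply: nIu; apply: KI; split.
have : (E1 `&` E2) x.
  split; apply: inK => // f kf; apply: JI.
    by exists f, (cst 0); split=> //; apply/funext => z /=; rewrite addr0.
  by exists (cst 0), f; split=> //; apply/funext => z /=; rewrite add0r.
by rewrite E12.
Qed.

Let lift f (Af : A f) : A := SigSub (mem_set Af).

Lemma character_one (phi : A -> cplx R) (f : A) : is_character phi ->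
  val f = cst 1 -> phi f = 1.
Proof.
move=> cphi f1; have [g g0] := char_neq0 cphi.
apply: (mulIf g0); rewrite mul1r; apply/esym/(char_mul cphi).
by rewrite f1; apply/funext => x /=; rewrite mul1r.
Qed.

Lemma character_kernel_maximal (phi : A -> cplx R) : is_character phi ->
  maximal_ideal A [set val f | f in phi @^-1` [set 0]].
Proof.
move=> cphi.
have one : val (lift (uca_cst algA 1)) = cst 1 by [].
split; first split.
- by move=> _ [f _ <-]; exact: set_mem (valP f).
- exists (lift (uca_cst algA 0)) => //=.
  rewrite (char_scale cphi (c := 0) (f := lift (uca_cst algA 1))) ?mul0r//.
  by apply/funext => x /=; rewrite scale0r.
- move=> _ _ [f f0 <-] [g g0 <-].
  have Afg := uca_add algA (set_mem (valP f)) (set_mem (valP g)).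
  exists (lift Afg) => //=; rewrite (char_add cphi (f := f) (g := g))//.
  by rewrite f0 g0 addr0.
- move=> f _ Af [g g0 <-]; have Afg := uca_mul algA Af (set_mem (valP g)).
  exists (lift Afg) => //=; rewrite (char_mul cphi (f := lift Af) (g := g))//.
  by rewrite g0 mulr0.
- move=> [f f0 f1]; have := character_one cphi f1.
  by rewrite f0 => /esym/eqP; rewrite oner_eq0.
move=> f Af nf; set c := phi (lift Af).
have c0 : c != 0 by apply/eqP => c0; apply: nf; exists (lift Af).
exists (cst c^-1); first exact: (uca_cst algA).
have Ag : A (f \* cst c^-1) by apply: (uca_mul algA Af); exact: (uca_cst algA).
have Ag' : A (- 1 \*: (f \* cst c^-1)) by exact: (uca_scale algA).
have Ah := uca_sub algA (uca_cst algA 1) Ag.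
exists (lift Ah) => //=.
rewrite (char_add cphi (f := lift (uca_cst algA 1)) (g := lift Ag')); last first.
  by apply/funext => x /=; rewrite scaleN1r.
rewrite (character_one cphi one) (char_scale cphi (c := -1) (f := lift Ag))//.
rewrite (char_scale cphi (c := c^-1) (f := lift Af)); last first.
  by apply/funext => x /=; rewrite mulrC.
by rewrite -/c mulVf// mulN1r subrr.
Qed.

Lemma evaluation_character x : is_character (evaluation A x).
Proof.
split.
- by move=> f g h E'; rewrite /evaluation E'.
- by move=> c f h E'; rewrite /evaluation E'.
- by move=> f g h E'; rewrite /evaluation E'.
by exists (lift (uca_cst algA 1)); rewrite /evaluation /= oner_neq0.
Qed.

Lemma character_spaceE : character_space A = range (evaluation A).
Proof.
apply/seteqP; split=> [phi cphi|_ [x _ <-]]; last exact: evaluation_character.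
have [x [kerE _]] := maximal_idealE (character_kernel_maximal cphi).
exists x => //; apply/funext => f; rewrite /evaluation.
have Af := set_mem (valP f).
have [c fc] : exists c, phi f = c by exists (phi f).
have Ac := uca_cst algA (- c).
have : [set val f | f in phi @^-1` [set 0]] (val f \+ cst (- c)).
  exists (lift (uca_add algA Af Ac)) => //=.
  rewrite (char_add cphi (f := f) (g := lift Ac))//.
  rewrite (char_scale cphi (c := - c) (f := lift (uca_cst algA 1)) (h := lift Ac)); last first.
    by apply/funext => z /=; rewrite /GRing.scale /= mulr1.
  by rewrite (character_one cphi (f := lift (uca_cst algA 1)))// mulr1 fc subrr.
by rewrite kerE fc => -[_ /eqP]; rewrite /= subr_eq0 => /eqP.
Qed.

Lemma continuous_evaluation : continuous (evaluation A).
Proof.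
move=> x; apply/cvg_sup => f; rewrite cvg_image; last first.
  by apply/seteqP; split=> v // _; exists (fun=> v).
move=> W /(fa_continuous fA (set_mem (valP f))) Wx.
exists (@^~ f @^-1` W); first exact: Wx.
by apply/seteqP; split=> [_ [phi + <-]|v Wv] //; exists (fun=> v).
Qed.

(** By [character_spaceE] the evaluation map is a continuous surjection of [X]
    onto the character space, along which closed sets are pulled back. *)
Lemma normal_algebra_small_exceptional_set : normal_algebra A.
Proof.
move=> E1 E2 cl1 cl2 E12.
pose e x : character_space A := SigSub (mem_set (evaluation_character x)).
have ce : continuous e.
  by apply: continuous_comp_initial; exact: continuous_evaluation.
have clp (K : set (character_space A)) : closed K -> closed (e @^-1` K).
  by apply: preimage_closed => x _; exact: ce.
have [|f Af [f1 f2]] := normal_on_base (clp _ cl1) (clp _ cl2).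
  by rewrite -preimage_setI E12 preimage_set0.
exists (gelfand_transform (lift Af)); first by exists (lift Af).
have onto (phi : character_space A) : exists2 x, phi = e x & val phi (lift Af) = f x.
  have : range (evaluation A) (val phi).
    by rewrite -character_spaceE; exact: set_mem (valP phi).
  case=> x _ ex.
  by exists x; [exact: val_inj|rewrite -ex].
split=> _ [phi Kphi <-]; rewrite /gelfand_transform /=.
  have [x phix ->] := onto phi; apply: f1; exists x => //=.
  by rewrite -phix.
have [x phix ->] := onto phi; apply: f2; exists x => //=.
by rewrite -phix.
Qed.

End SmallExceptionalSet.

Unset Implicit Arguments.

Theorem theorem7 (R : realType) (X : topologicalType) (A : set (X -> cplx R)) :
  compact_space X ->
  uniform_algebra A ->
  let E := [set x : X |
    norm_closure A uniform_norm (local_ideal A x) <> max_ideal A x] in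
  (forall P : set X, perfect_set P -> P `<=` E -> P = set0) ->
  character_space A = range (evaluation A) /\ normal_algebra A.
Proof.
move=> [cX _] uA E noperfE; split; first exact: character_spaceE.
exact: normal_algebra_small_exceptional_set.
Qed.
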